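(* Let ${\bm{P}}\succ0$ and ${\bm{H}}\succeq0$ be symmetric $d\times d$ matrices with ${\bm{P}}{\bm{H}}={\bm{H}}{\bm{P}}$, and let $\tilde\lambda_1\ge\cdots\ge\tilde\lambda_d>0$ be the eigenvalues of ${\bm{P}}^{-1}{\bm{H}}$. Fix $\eta>0$, $\beta_1\in[0,1)$, and set $\tilde\eta:=(1-\beta_1)\eta$. Let $\sigma_1,\ldots,\sigma_d>0$ be such that, in an orthonormal basis simultaneously diagonalizing ${\bm{P}}$ and ${\bm{H}}$, ${\bm{P}}=\mathrm{diag}(\sigma_1,\ldots,\sigma_d)$ and ${\bm{P}}^{-1/2}{\bm{H}}{\bm{P}}^{-1/2}=\mathrm{diag}(\tilde\lambda_1,\ldots,\tilde\lambda_d)$. Let ${\mathcal{X}}:=(\mathbb{S}^2)^d$, ${\mathcal{K}}:=(\mathbb{S}^2_+)^d$, and define ${\mathcal{T}}_{\mathrm{adam}}:{\mathcal{X}}\to{\mathcal{X}}$ by \[ ({\mathcal{T}}_{\mathrm{adam}}({\bm{W}}))_i={\bm{A}}_i{\bm{W}}_i{\bm{A}}_i^\top+\tilde\eta^2\Bigl(\tilde\lambda_i^2({\bm{W}}_i)_{11}+\sigma_i^{-1}\sum_{j=1}^d\sigma_j\tilde\lambda_j^2({\bm{W}}_j)_{11}\Bigr){\bm{Q}},\quad i=1,\ldots,d, \] with ${\bm{A}}_i=\begin{bmatrix}1-\tilde\eta\tilde\lambda_i&-\beta_1\\ \tilde\eta\tilde\lambda_i&\beta_1\end{bmatrix}$,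 ${\bm{Q}}=\begin{bmatrix}1&-1\\-1&1\end{bmatrix}$. Let $S_{\mathrm{adam}}(\eta,\beta_1):=\sum_{i=1}^d\frac{\eta\tilde\lambda_i}{2\left(1-\frac{\eta\tilde\lambda_i}{1+\beta_1}\right)}$. Then: (a) ${\mathcal{T}}_{\mathrm{adam}}({\mathcal{K}})\subseteq{\mathcal{K}}$; moreover ${\mathcal{T}}_{\mathrm{adam}}$ has an eigenvalue equal to its spectral radius $\rho({\mathcal{T}}_{\mathrm{adam}})$ with an associated eigenvector ${\bm{W}}^\star\in{\mathcal{K}}\setminus\{{\bm{0}}\}$, and $\rho({\mathcal{T}}_{\mathrm{adam}})\ge\tilde\eta^2\sum_{i=1}^d\tilde\lambda_i^2>0$ and $\sum_{i=1}^d({\bm{W}}_i^\star)_{11}>0$. (b) $\rho({\mathcal{T}}_{\mathrm{adam}})=1$ if and only if $\eta\tilde\lambda_1<1+\beta_1$ and $S_{\mathrm{adam}}(\eta,\beta_1)=1$. (c) $\rho({\mathcal{T}}_{\mathrm{adam}})<1$ if and only if $\eta\tilde\lambda_1<1+\beta_1$ and $S_{\mathrm{adam}}(\eta,\beta_1)<1$.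
   Context: $\mathbb{S}^2$ denotes the space of real symmetric $2\times2$ matrices and $\mathbb{S}^2_+$ the cone of positive semidefinite ones; $\rho(\cdot)$ denotes spectral radius. *)

(* Defs.v *)
From HB Require Import structures.
From mathcomp Require Import all_boot all_order all_algebra.
From mathcomp Require Import complex.
From mathcomp Require Import classical_sets reals.

Set Implicit Arguments.
Unset Strict Implicit.
Unset Printing Implicit Defensive.

Import Order.TTheory GRing.Theory Num.Theory.
Local Open Scope ring_scope.
Local Open Scope complex_scope.

Definition sym2 {K : nzRingType} (W : 'M[K]_2) : Prop := W^T = W.

Definition psd2 {R : realFieldType} (W : 'M[R]_2) : Prop :=
  sym2 W /\ forall x : 'cV[R]_2, 0 <= (x^T *m W *m x) 0 0.

Definition inX {K : nzRingType} {d : nat} (W : 'I_d -> 'M[K]_2) : Prop :=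
  forall i, sym2 (W i).
Definition inK {R : realFieldType} {d : nat} (W : 'I_d -> 'M[R]_2) : Prop :=
  forall i, psd2 (W i).
Definition nonzeroX {K : nzRingType} {d : nat} (W : 'I_d -> 'M[K]_2) : Prop :=
  exists i, W i != 0.

Definition Qmx {K : nzRingType} : 'M[K]_2 :=
  \matrix_(i < 2, j < 2) (if i == j then 1 else -1).

Definition Amx {K : nzRingType} (et b1 l : K) : 'M[K]_2 :=
  \matrix_(i < 2, j < 2)
    (if i == 0 then (if j == 0 then 1 - et * l else - b1)
               else (if j == 0 then et * l else b1)).

(* T_adam, written over an arbitrary field K (K = R for the operator on X,
   K = R[i] for its complexification). Parameters: eta, beta1, lam_i
   (= tilde lambda_i), sig_i (= sigma_i).  tilde eta = (1 - beta1) eta. *)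
Definition Tadam {K : fieldType} {d : nat} (eta b1 : K) (lam sig : 'I_d -> K)
    (W : 'I_d -> 'M[K]_2) (i : 'I_d) : 'M[K]_2 :=
  let et := (1 - b1) * eta in
  Amx et b1 (lam i) *m W i *m (Amx et b1 (lam i))^T
  + (et ^+ 2 * (lam i ^+ 2 * W i 0 0
       + (sig i)^-1 * \sum_(j < d) sig j * lam j ^+ 2 * W j 0 0)) *: Qmx.

(* z \in C is an eigenvalue of the real linear operator T_adam on X, i.e.
   an eigenvalue of its complexification X_C = (S^2(C))^d. *)
Definition Tadam_eigenvalue {R : realType} {d : nat} (eta b1 : R)
    (lam sig : 'I_d -> R) (z : R[i]) : Prop :=
  exists W : 'I_d -> 'M[R[i]]_2,
    inX W /\ nonzeroX W /\
    forall i, Tadam (eta%:C) (b1%:C) (fun j => (lam j)%:C) (fun j => (sig j)%:C)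
                    W i = z *: W i.

Definition cmod {R : rcfType} (z : R[i]) : R := ComplexField.Normc.normc z.

Definition rho_adam {R : realType} {d : nat} (eta b1 : R)
    (lam sig : 'I_d -> R) : R :=
  reals.sup [set cmod z | z in [set z | Tadam_eigenvalue eta b1 lam sig z]]%classic.

Definition S_adam {R : realFieldType} {d : nat} (eta b1 : R) (lam : 'I_d -> R) : R :=
  \sum_(i < d) (eta * lam i) / (2 * (1 - eta * lam i / (1 + b1))).

(* Main.v *)
Require Import Defs.
From HB Require Import structures.
From mathcomp Require Import all_boot all_order all_algebra.
From mathcomp Require Import complex.
From mathcomp Require Import classical_sets reals topology normedtype sequences.
From mathcomp Require Import ring lra.

Set Implicit Arguments.
Unset Strict Implicit.
Unset Printing Implicit Defensive.

Import Order.TTheory GRing.Theory Num.Theory.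
Import ComplexField.Normc numFieldNormedType.Exports.
Local Open Scope ring_scope.
Local Open Scope complex_scope.

(* At a real vector v, the quadratic form of T(W)_i is a combination with
   nonnegative coefficients of values of the quadratic forms of the W_j.  Hence T
   preserves K, and it also preserves a bound |v^T V_i v| <= t v^T W_i v.  Let W
   be a positive definite eigenvector, with eigenvalue x.  A complex eigenvector V
   with eigenvalue z satisfies such a bound for some t, and applying T replaces t
   by t x / |z|, so that V = 0 if |z| > x.  Therefore x is the spectral radius.

   To find W, put a_i = (1 - b) eta lam_i.  For x > b, the equation
   x L = A_i L A_i^T + Q has a solution with first entry 1 / k_i(x), which is
   positive definite when k_i(x) > 0.  Suitable multiples of these solutions form
   an eigenvector with eigenvalue x as soon as
     F(x) = sum_i a_i^2 / (k_i(x) - a_i^2) = 1.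
   On the half-line D where x > b and all k_i(x) > a_i^2, each k_i is increasing,
   so F is decreasing and takes the value 1 exactly once.  Finally, 1 is in D iff
   eta lam_1 < 1 + b, and F(1) = S_adam, which locates the root relative to 1. *)

Lemma sumr_ord_gt0 {R : numDomainType} {d : nat} (F : 'I_d -> R) :
  (0 < d)%N -> (forall i, 0 < F i) -> 0 < \sum_i F i.
Proof.
case: d F => // d F _ F_gt0; rewrite big_ord_recl ltr_pwDl// sumr_ge0// => i _.
exact: ltW.
Qed.

Lemma cmod_ge0 {R : rcfType} (z : R[i]) : 0 <= cmod z.
Proof. by case: z => x y; exact: sqrtr_ge0. Qed.

Lemma mxOver_realP {R : rcfType} m n (A : 'M[R[i]]_(m, n)) :
  A \is a mxOver Num.real -> exists B : 'M[R]_(m, n), A = map_mx (real_complex R) B.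
Proof.
move=> /mxOverP AR; exists (map_mx (@complex.Re R) A).
by apply/matrixP => i j; rewrite !mxE RRe_real.
Qed.

(** * Quadratic forms *)

Definition qform {K : pzRingType} {n : nat} (W : 'M[K]_n) (v : 'cV[K]_n) : K :=
  (v^T *m W *m v) 0 0.

Section QuadraticForm.
Variables (K : comPzRingType) (n : nat).
Implicit Types (A W : 'M[K]_n) (v : 'cV[K]_n).

Lemma qformD W1 W2 v : qform (W1 + W2) v = qform W1 v + qform W2 v.
Proof. by rewrite /qform mulmxDr mulmxDl mxE. Qed.

Lemma qformZ a W v : qform (a *: W) v = a * qform W v.
Proof. by rewrite /qform -scalemxAr -scalemxAl mxE. Qed.

Lemma qform_congr A W v : qform (A *m W *m A^T) v = qform W (A^T *m v).
Proof. by rewrite /qform trmx_mul trmxK !mulmxA. Qed.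

Lemma qform_delta W i : qform W (delta_mx i 0) = W i i.
Proof. by rewrite /qform trmx_delta -rowE -colE !mxE. Qed.

End QuadraticForm.

Lemma map_qform {K L : pzRingType} (f : {rmorphism K -> L}) n
    (W : 'M[K]_n) (v : 'cV[K]_n) :
  qform (map_mx f W) (map_mx f v) = f (qform W v).
Proof. by rewrite /qform map_trmx -!map_mxM mxE. Qed.

Lemma eq_mx2 {T : Type} (A B : 'M[T]_2) :
  A 0 0 = B 0 0 -> A 0 1 = B 0 1 -> A 1 0 = B 1 0 -> A 1 1 = B 1 1 -> A = B.
Proof.
move=> eq00 eq01 eq10 eq11; apply/matrixP => i j.
have ord2 (k : 'I_2) : k = 0 \/ k = 1.
  by case: k => [[|[|//]] lt_k2]; [left|right]; apply: val_inj.
by case: (ord2 i) => ->; case: (ord2 j) => ->.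
Qed.

Lemma mulmx2E {K : pzRingType} m n (A : 'M[K]_(m, 2)) (B : 'M[K]_(2, n)) i j :
  (A *m B) i j = A i 0 * B 0 j + A i 1 * B 1 j.
Proof.
rewrite mxE big_ord_recl big_ord1; congr (_ + A i _ * B _ j); exact: val_inj.
Qed.

Lemma sym2P {K : nzRingType} (W : 'M[K]_2) : sym2 W <-> W 1 0 = W 0 1.
Proof.
split=> [symW|W10]; first by rewrite -{1}symW mxE.
by apply: eq_mx2; rewrite mxE ?W10.
Qed.

Lemma qform2E {K : comNzRingType} (W : 'M[K]_2) v : sym2 W ->
  qform W v =
  v 0 0 ^+ 2 * W 0 0 + 2 * v 0 0 * v 1 0 * W 0 1 + v 1 0 ^+ 2 * W 1 1.
Proof. by move/sym2P => W10; rewrite /qform !mulmx2E !mxE W10; ring. Qed.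

Lemma qform_Qmx {K : comNzRingType} (v : 'cV[K]_2) :
  qform Qmx v = (v 0 0 - v 1 0) ^+ 2.
Proof. by rewrite /qform !mulmx2E !mxE /=; ring. Qed.

Lemma qform2_eq0 {K : numFieldType} (W : 'M[K]_2) : sym2 W ->
  (forall v, v \is a mxOver Num.real -> qform W v = 0) -> W = 0.
Proof.
move=> symW W0; have := W0 (const_mx 1); rewrite qform2E// !mxE !expr1n.
have Wii i : W i i = 0.
  by rewrite -qform_delta W0//; apply/mxOverP => j k; rewrite mxE realn.
rewrite !Wii !mulr1 !mulr0 add0r addr0 mxOver_const// => /(_ isT)/eqP.
rewrite mulf_eq0 pnatr_eq0/= => /eqP W01.
by apply: eq_mx2; rewrite mxE// (sym2P W).1.
Qed.

Lemma norm_qform2_le {K : numFieldType} (W : 'M[K]_2) v :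
  sym2 W -> v \is a mxOver Num.real ->
  `|qform W v| <= (`|W 0 0| + `|W 0 1| + `|W 1 1|) * (v 0 0 ^+ 2 + v 1 0 ^+ 2).
Proof.
move=> symW /mxOverP vR; have [v0R v1R] := (vR 0 0, vR 1 0).
have [v0_ge0 v1_ge0] : 0 <= v 0 0 ^+ 2 /\ 0 <= v 1 0 ^+ 2.
  by rewrite !real_exprn_even_ge0.
have amgm : 2 * `|v 0 0| * `|v 1 0| <= v 0 0 ^+ 2 + v 1 0 ^+ 2.
  rewrite -(real_normK v0R) -(real_normK v1R) -subr_ge0.
  have : 0 <= (`|v 0 0| - `|v 1 0|) ^+ 2.
    by rewrite real_exprn_even_ge0 ?rpredB ?normr_real.
  by congr (_ <= _); ring.
rewrite qform2E// [leRHS]mulrDl [in leRHS]mulrDl.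
apply: le_trans (ler_normD _ _) _; apply: lerD.
  apply: le_trans (ler_normD _ _) _; apply: lerD.
    by rewrite normrM mulrC ler_wpM2l// ger0_norm// lerDl.
  by rewrite !normrM normr_nat mulrC ler_wpM2l.
by rewrite normrM mulrC ler_wpM2l// ger0_norm// lerDr.
Qed.

Definition pd2 {R : realFieldType} (W : 'M[R]_2) : Prop :=
  [/\ sym2 W, 0 < W 0 0 & W 0 1 ^+ 2 < W 0 0 * W 1 1].

Section PositiveDefinite.
Variable R : realFieldType.
Implicit Types W : 'M[R]_2.

Lemma pd2_neq0 W : pd2 W -> W != 0.
Proof. by case=> _ W00 _; apply: contraTneq W00 => ->; rewrite mxE ltxx. Qed.

Lemma pd2Z a W : 0 < a -> pd2 W -> pd2 (a *: W).
Proof.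
move=> a_gt0 [symW W00 W01]; split.
- by rewrite /sym2 linearZ/= symW.
- by rewrite mxE mulr_gt0.
- by rewrite !mxE exprMn [ltRHS]mulrACA -expr2 ltr_pM2l ?exprn_gt0.
Qed.

Lemma pd2_coercive W : pd2 W -> exists2 m, 0 < m &
  forall v : 'cV_2, m * (v 0 0 ^+ 2 + v 1 0 ^+ 2) <= qform W v.
Proof.
case=> symW W00 W01.
have W11 : 0 < W 1 1.
  by rewrite -(pmulr_rgt0 _ W00); apply: le_lt_trans W01; exact: sqr_ge0.
have tr_gt0 : 0 < W 0 0 + W 1 1 by exact: addr_gt0.
exists ((W 0 0 * W 1 1 - W 0 1 ^+ 2) / (W 0 0 + W 1 1)).
  by rewrite divr_gt0// subr_gt0.
move=> v; rewrite mulrAC ler_pdivrMr// qform2E// -subr_ge0.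
(* By Cayley-Hamilton, (tr W) W - (det W) I = W^2 = W^T W. *)
set gap := (X in 0 <= X).
have -> : gap = (W 0 0 * v 0 0 + W 0 1 * v 1 0) ^+ 2 +
                (W 0 1 * v 0 0 + W 1 1 * v 1 0) ^+ 2 by rewrite /gap; ring.
by rewrite addr_ge0 ?sqr_ge0.
Qed.

Lemma pd2_psd W : pd2 W -> psd2 W.
Proof.
move=> pdW; have [symW _ _] := pdW; have [m m_gt0 le_W] := pd2_coercive pdW.
split=> // v; apply: le_trans (le_W v).
by rewrite mulr_ge0 ?addr_ge0 ?sqr_ge0 ?ltW.
Qed.

End PositiveDefinite.

Lemma pd2_dominates {R : rcfType} (V : 'M[R[i]]_2) (W : 'M[R]_2) :
  sym2 V -> pd2 W -> exists2 t, 0 <= t & forall v : 'cV[R]_2,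
    `|qform V (map_mx (real_complex R) v)| <= (t * qform W v)%:C.
Proof.
move=> symV pdW; have [m m_gt0 le_W] := pd2_coercive pdW.
pose M := cmod (V 0 0) + cmod (V 0 1) + cmod (V 1 1).
have M_ge0 : 0 <= M by rewrite !addr_ge0 ?cmod_ge0.
exists (M / m) => [|v]; first by rewrite divr_ge0// ltW.
have vR : map_mx (real_complex R) v \is a mxOver Num.real.
  by apply/mxOverP => i j; rewrite mxE complex_real.
apply: le_trans (norm_qform2_le symV vR) _.
rewrite !mxE -!rmorphXn -!rmorphD/= -rmorphM lecR mulrAC ler_pdivlMr//.
by rewrite -[leLHS]mulrA ler_wpM2l// mulrC.
Qed.

(** * The operator and its cone *)

Section TadamAlgebra.
Variables (K : fieldType) (d : nat) (eta b : K) (lam sig : 'I_d -> K).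
Implicit Types W : 'I_d -> 'M[K]_2.
Local Notation T := (Tadam eta b lam sig).
Local Notation et := ((1 - b) * eta).

Lemma Tadam_inX W : inX W -> inX (T W).
Proof.
move=> symW i; rewrite /sym2 linearD linearZ/= !trmx_mul trmxK symW mulmxA.
by congr (_ + _ *: _); apply/sym2P; rewrite !mxE.
Qed.

Lemma qform_Tadam W i v :
  qform (T W i) v = qform (W i) ((Amx et b (lam i))^T *m v) +
    et ^+ 2 * (lam i ^+ 2 * W i 0 0 +
               (sig i)^-1 * \sum_j sig j * lam j ^+ 2 * W j 0 0) *
    (v 0 0 - v 1 0) ^+ 2.
Proof. by rewrite qformD qform_congr qformZ qform_Qmx. Qed.

Lemma map_Tadam (L : fieldType) (f : {rmorphism K -> L}) W i :
  Tadam (f eta) (f b) (f \o lam) (f \o sig) (fun j => map_mx f (W j)) i =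
  map_mx f (T W i).
Proof.
have map_Amx e l : map_mx f (Amx e b l) = Amx (f e) (f b) (f l).
  by apply: eq_mx2; rewrite !mxE/= ?(rmorphB, rmorphN, rmorphM, rmorph1).
have map_Qmx : map_mx f Qmx = Qmx.
  by apply: eq_mx2; rewrite !mxE/= ?(rmorphN, rmorph1).
rewrite /Tadam map_mxD map_mxZ !map_mxM -map_trmx map_Amx map_Qmx.
rewrite !(rmorphXn, rmorphM, rmorphB, rmorphD, fmorphV, rmorph1, rmorph_sum).
congr (_ + (_ * (_ * _ + _ * _)) *: _); first by rewrite mxE.
by apply: eq_bigr => j _; rewrite !(rmorphXn, rmorphM) mxE.
Qed.

End TadamAlgebra.

Definition dominated {K : numDomainType} {d : nat} (t : K)
    (V W : 'I_d -> 'M[K]_2) : Prop :=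
  forall i v, v \is a mxOver Num.real -> `|qform (V i) v| <= t * qform (W i) v.

Lemma dominated_Tadam {K : numFieldType} {d : nat} (eta b : K)
    (lam sig : 'I_d -> K) (V W : 'I_d -> 'M[K]_2) (t : K) :
  eta \is Num.real -> b \is Num.real -> (forall i, lam i \is Num.real) ->
  (forall i, 0 < sig i) -> dominated t V W ->
  dominated t (Tadam eta b lam sig V) (Tadam eta b lam sig W).
Proof.
move=> etaR bR lamR sig_gt0 VW i v vR; rewrite !qform_Tadam [leRHS]mulrDr.
have etR : (1 - b) * eta \is Num.real by rewrite rpredM ?rpredB ?rpred1.
apply: le_trans (ler_normD _ _) _; apply: lerD.
  apply: VW; rewrite mxOverM//; apply/mxOverP => j k; rewrite !mxE.
  by case: ifP => _; case: ifP => _; rewrite ?(rpredB, rpred1, rpredN, rpredM).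
have VW00 j : `|V j 0 0| <= t * W j 0 0.
  by rewrite -!qform_delta VW//; apply/mxOverP => k l; rewrite mxE realn.
have sqr_ge0R (x : K) : x \is Num.real -> 0 <= x ^+ 2.
  by move=> xR; rewrite real_exprn_even_ge0.
have diff_v : v 0 0 - v 1 0 \is Num.real by rewrite rpredB// (mxOverP vR).
rewrite [leRHS]mulrA normrM (ger0_norm (sqr_ge0R _ diff_v)).
rewrite ler_wpM2r ?sqr_ge0R//.
rewrite [leRHS]mulrCA normrM (ger0_norm (sqr_ge0R _ etR)) ler_wpM2l ?sqr_ge0R//.
rewrite [leRHS]mulrDr; apply: le_trans (ler_normD _ _) _; apply: lerD.
  rewrite [leRHS]mulrCA normrM (ger0_norm (sqr_ge0R _ (lamR i))).
  by rewrite ler_wpM2l ?sqr_ge0R.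
have sigV_ge0 : 0 <= (sig i)^-1 by rewrite invr_ge0 ltW.
rewrite [leRHS]mulrCA normrM (ger0_norm sigV_ge0) ler_wpM2l// mulr_sumr.
apply: le_trans (ler_norm_sum _ _ _) _; apply: ler_sum => j _.
have sig_lam_ge0 : 0 <= sig j * lam j ^+ 2.
  by rewrite mulr_ge0 ?sqr_ge0R ?(ltW (sig_gt0 j)).
by rewrite [leRHS]mulrCA normrM (ger0_norm sig_lam_ge0) ler_wpM2l.
Qed.

(* W lies in K iff it is symmetric and dominated by itself. *)
Lemma Tadam_inK {R : realFieldType} {d : nat} (eta b : R) (lam sig : 'I_d -> R)
    (W : 'I_d -> 'M[R]_2) :
  (forall i, 0 < sig i) -> inK W -> inK (Tadam eta b lam sig W).
Proof.
move=> sig_gt0 WK i; split; first by apply: Tadam_inX => j; have [] := WK j.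
have WW : dominated 1 W W.
  by move=> j v _; rewrite mul1r ger0_norm//; exact: (WK j).2.
have TW : dominated 1 (Tadam eta b lam sig W) (Tadam eta b lam sig W).
  by apply: dominated_Tadam WW => // *; exact: num_real.
move=> v; have vR : v \is a mxOver Num.real.
  by apply/mxOverP => j k; exact: num_real.
have := TW i v vR; rewrite mul1r; exact: le_trans (normr_ge0 _).
Qed.

Section SpectralRadius.
Variables (R : realType) (d : nat) (eta b : R) (lam sig : 'I_d -> R).
Implicit Types (V : 'I_d -> 'M[R[i]]_2) (W : 'I_d -> 'M[R]_2) (k t x : R).
Hypothesis sig_gt0 : forall i, 0 < sig i.

Local Notation T := (Tadam eta b lam sig).
Local Notation TC :=
  (Tadam eta%:C b%:C (fun j => (lam j)%:C) (fun j => (sig j)%:C)).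
Local Notation toC W := (fun i => map_mx (real_complex R) (W i)).

Lemma exists_dominated V W : inX V -> (forall i, pd2 (W i)) ->
  exists t, dominated t%:C V (toC W).
Proof.
move=> symV pdW.
have /fin_all_exists2[t t_ge0 le_t] i : exists2 t, 0 <= t & forall v : 'cV[R]_2,
    `|qform (V i) (map_mx (real_complex R) v)| <= (t * qform (W i) v)%:C.
  exact: pd2_dominates.
exists (\sum_i t i) => i _ /mxOver_realP[v ->].
rewrite map_qform -rmorphM; apply: le_trans (le_t i v) _; rewrite lecR.
apply: ler_wpM2r; first exact: (pd2_psd (pdW i)).2.
by rewrite (bigD1 i)//= lerDl sumr_ge0.
Qed.

Lemma dominated_eigen V W x z (t : R[i]) : 0 < cmod z ->
  (forall i, TC V i = z *: V i) -> (forall i, T W i = x *: W i) ->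
  dominated t V (toC W) -> dominated ((x / cmod z)%:C * t) V (toC W).
Proof.
move=> z_gt0 TV TW VW i v vR.
have xzE : (cmod z)%:C * (x / cmod z)%:C = x%:C.
  by rewrite -rmorphM/= mulrC divfK// gt_eqF.
have zC_gt0 : 0 < (cmod z)%:C by rewrite ltcR.
have : dominated t (TC V) (TC (toC W)).
  by apply: dominated_Tadam VW => *; rewrite ?ltcR// complex_real.
move=> /(_ i v vR); rewrite map_Tadam TV TW map_mxZ !qformZ normrM => le_zV.
by rewrite -(ler_pM2l zC_gt0) !mulrA xzE [x%:C * t]mulrC -mulrA.
Qed.

Lemma dominated_geometric_eq0 V W k t : `|k| < 1 -> inX V ->
  (forall n, dominated ((k ^+ n)%:C * t%:C) V (toC W)) -> forall i, V i = 0.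
Proof.
move=> k_lt1 symV VW i; apply: qform2_eq0 => // v vR.
apply: eq0_normc; apply/eqP; rewrite eq_le cmod_ge0 andbT.
have [u uE] := mxOver_realP vR.
have := cvg_geometric (t * qform (W i) u) k_lt1.
move/cvgr_to_ge; apply; apply: nearW => n /=.
have := VW n i v vR; rewrite uE map_qform -!rmorphM lecR.
by rewrite -[k ^+ n * t * _]mulrA mulrC.
Qed.

Lemma Tadam_eigenvalue_le W x z : (forall i, pd2 (W i)) -> 0 <= x ->
  (forall i, T W i = x *: W i) -> Tadam_eigenvalue eta b lam sig z ->
  cmod z <= x.
Proof.
move=> pdW x_ge0 TW [V [symV [[i Vi] TV]]]; rewrite leNgt; apply/negP => xz.
have z_gt0 : 0 < cmod z by exact: le_lt_trans xz.
have [t VW] := exists_dominated symV pdW.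
case/eqP: Vi; apply: (@dominated_geometric_eq0 V W (x / cmod z) t) => //.
  by rewrite ger0_norm ?divr_ge0 ?(ltW z_gt0)// ltr_pdivrMr// mul1r.
elim=> [|n IHn]; first by rewrite expr0 mul1r.
by rewrite exprS rmorphM -mulrA; exact: dominated_eigen IHn.
Qed.

Lemma Tadam_eigenvalue_pd W x : (0 < d)%N -> (forall i, pd2 (W i)) ->
  (forall i, T W i = x *: W i) -> Tadam_eigenvalue eta b lam sig x%:C.
Proof.
move=> d_gt0 pdW TW; exists (toC W); split; last split.
- by move=> i; have [symW _ _] := pdW i; rewrite /sym2 map_trmx symW.
- by exists (Ordinal d_gt0); rewrite map_mx_eq0 pd2_neq0.
- by move=> i; rewrite map_Tadam TW map_mxZ.
Qed.

Lemma rho_adamE W x : (0 < d)%N -> (forall i, pd2 (W i)) -> 0 <= x ->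
  (forall i, T W i = x *: W i) -> rho_adam eta b lam sig = x.
Proof.
move=> d_gt0 pdW x_ge0 TW.
pose E := [set cmod z | z in Tadam_eigenvalue eta b lam sig]%classic.
have ub_x : ubound E x by move=> _ [z zT <-]; exact: Tadam_eigenvalue_le zT.
have Ex : E x.
  exists x%:C; first exact: Tadam_eigenvalue_pd TW.
  by rewrite /cmod/= expr0n addr0 sqrtr_sqr ger0_norm.
by apply/eqP; rewrite eq_le ge_sup ?ub_le_sup//; exists x.
Qed.

End SpectralRadius.

(** * The block equation x L = A L A^T + Q *)

(* [c] and [b] stand for the trace and the determinant of the matrix A of the
   block; (inv_gain b c x)^-1 is the entry L 0 0. *)
Definition inv_gain {K : fieldType} (b c x : K) : K :=
  x - b ^+ 2 / x - c ^+ 2 * (x - b) / (x + b).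

Section InvGainOrder.
Variables (R : realFieldType) (b c : R).

Lemma inv_gain_gt0 x : 0 <= b -> b < x ->
  (0 < inv_gain b c x) = (c ^+ 2 * x < (x + b) ^+ 2).
Proof.
move=> b_ge0 bx; have [x_gt0 xb_gt0] : 0 < x /\ 0 < x + b by split; lra.
have -> : inv_gain b c x =
    (x - b) / (x * (x + b)) * ((x + b) ^+ 2 - c ^+ 2 * x).
  by rewrite /inv_gain; field; rewrite !gt_eqF.
by rewrite pmulr_rgt0 ?subr_gt0// divr_gt0 ?subr_gt0 ?mulr_gt0.
Qed.

Lemma inv_gain_lt x y : 0 <= b -> b < x -> x < y -> 0 < inv_gain b c x ->
  inv_gain b c x < inv_gain b c y.
Proof.
move=> b_ge0 bx xy; rewrite inv_gain_gt0// => disc; rewrite -subr_gt0.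
have [x_gt0 y_gt0] : 0 < x /\ 0 < y by split; lra.
have [xb_gt0 yb_gt0] : 0 < x + b /\ 0 < y + b by split; lra.
have -> : inv_gain b c y - inv_gain b c x =
    (y - x) / (x * y * (x + b) * (y + b)) *
    ((y - b) * (x * y - b ^+ 2) * (x + b) +
     2 * b * y * ((x + b) ^+ 2 - c ^+ 2 * x)).
  by rewrite /inv_gain; field; rewrite !gt_eqF.
rewrite mulr_gt0 ?divr_gt0 ?subr_gt0 ?mulr_gt0//.
apply: ltr_pwDl; last by rewrite !mulr_ge0 ?subr_ge0// ltW.
by rewrite !mulr_gt0 ?subr_gt0//; [lra|nra].
Qed.

Lemma inv_gain_le x : 0 <= b -> b < x -> inv_gain b c x <= x - b ^+ 2 / x.
Proof.
move=> b_ge0 bx; rewrite gerBl divr_ge0//; last lra.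
by rewrite mulr_ge0 ?sqr_ge0// subr_ge0 ltW.
Qed.

Lemma inv_gain_ge x : 0 <= b -> b < x -> x - b - c ^+ 2 <= inv_gain b c x.
Proof.
move=> b_ge0 bx; rewrite /inv_gain -!mulrA.
have : b ^+ 2 / x <= b by rewrite ler_pdivrMr; nra.
have : (x - b) / (x + b) <= 1 by rewrite ler_pdivrMr; lra.
by move/(ler_wpM2l (sqr_ge0 c)); lra.
Qed.

End InvGainOrder.

Lemma inv_gain_continuous {R : realType} (b c x : R) : x != 0 -> x + b != 0 ->
  {for x, continuous (inv_gain b c)}.
Proof.
move=> x_neq0 xb_neq0; apply: cvgB; first apply: cvgB; first exact: cvg_id.
  by apply: cvgM; [exact: cvg_cst|apply: cvgV => //; exact: cvg_id].
apply: cvgM; last apply: cvgV => //.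
  by apply: cvgM; [exact: cvg_cst|apply: cvgB; [exact: cvg_id|exact: cvg_cst]].
by apply: cvgD; [exact: cvg_id|exact: cvg_cst].
Qed.

Lemma inv_gain_surj {R : realType} (b c v : R) : 0 <= b -> 0 < v ->
  exists2 x, b < x & inv_gain b c x = v.
Proof.
move=> b_ge0 v_gt0; pose l := b + v / 2; pose r := b + c ^+ 2 + v.
have c_ge0 := sqr_ge0 c.
have [bl br] : b < l /\ b < r by split; rewrite /l /r; lra.
have le_v : inv_gain b c l <= v.
  apply: le_trans (inv_gain_le c b_ge0 bl) _.
  suff : b - v / 2 <= b ^+ 2 / l by rewrite /l; lra.
  by rewrite ler_pdivlMr /l; nra.
have ge_v : v <= inv_gain b c r.
  by apply: le_trans (inv_gain_ge c b_ge0 br); rewrite /r; lra.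
have [| | |x + <-] := @IVT _ (inv_gain b c) l r v.
- by rewrite /l /r; lra.
- apply: continuous_in_subspaceT => x; rewrite inE/= in_itv/= => /andP[lx _].
  by apply: inv_gain_continuous; rewrite gt_eqF//; lra.
- by rewrite ge_min le_v le_max ge_v orbT.
- by rewrite in_itv/= => /andP[lx _]; exists x => //; exact: lt_le_trans lx.
Qed.

(* Write e = (1, 0)^T and u = (1, 1)^T, so that A^T e = c e - b u, A^T u = e and
   Q u = 0.  The numbers p = e^T L e, q = e^T L u and r = u^T L u then satisfy
   x q = c p - b q and x r = p. *)
Definition lyapunov_sol {K : fieldType} (b c x : K) : 'M[K]_2 :=
  let p := (inv_gain b c x)^-1 in let q := c * p / (x + b) in let r := p / x in
  \matrix_(i < 2, j < 2) (if i == 0 then (if j == 0 then p else q - p)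
                         else (if j == 0 then q - p else r - 2 * q + p)).

Lemma lyapunov_solP {K : fieldType} (et b l x : K) :
  let c := 1 + b - et * l in
  x != 0 -> x + b != 0 -> inv_gain b c x != 0 ->
  Amx et b l *m lyapunov_sol b c x *m (Amx et b l)^T + Qmx =
  x *: lyapunov_sol b c x.
Proof.
move=> c x_neq0 xb_neq0 k_neq0.
have -> : Qmx = ((inv_gain b c x)^-1 * inv_gain b c x) *: Qmx :> 'M[K]_2.
  by rewrite mulVf// scale1r.
rewrite /lyapunov_sol; move: (inv_gain b c x)^-1 => p.
apply: eq_mx2; rewrite !(mulmx2E, mxE)/= /inv_gain /c; field;
  by rewrite x_neq0 xb_neq0.
Qed.

Lemma lyapunov_sol_pd {R : realFieldType} (b c x : R) : 0 <= b -> b < x ->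
  0 < inv_gain b c x -> pd2 (lyapunov_sol b c x).
Proof.
move=> b_ge0 bx k_gt0.
have disc : c ^+ 2 * x < (x + b) ^+ 2 by rewrite -inv_gain_gt0.
have [x_gt0 xb_gt0] : 0 < x /\ 0 < x + b by split; lra.
have p_gt0 : 0 < (inv_gain b c x)^-1 by rewrite invr_gt0.
split; [by apply/sym2P; rewrite !mxE|by rewrite mxE|].
rewrite !mxE/= -subr_gt0; move: (_^-1) p_gt0 => p p_gt0.
set det := (X in 0 < X).
have -> : det = p ^+ 2 * ((x + b) ^+ 2 - c ^+ 2 * x) / (x * (x + b) ^+ 2).
  by rewrite /det; field; rewrite !gt_eqF.
by rewrite divr_gt0 ?mulr_gt0 ?exprn_gt0 ?subr_gt0.
Qed.

(** * The secular equation *)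

Definition secular {K : fieldType} {d : nat} (b : K) (c w : 'I_d -> K)
    (x : K) : K :=
  \sum_i w i / (inv_gain b (c i) x - w i).

Definition secular_dom {R : realFieldType} {d : nat} (b : R) (c w : 'I_d -> R) :
    pred R :=
  [pred x | (b < x) && [forall i, w i < inv_gain b (c i) x]].

Lemma secular_domP {R : realFieldType} {d : nat} {b : R} {c w : 'I_d -> R} {x : R} :
  reflect (b < x /\ forall i, w i < inv_gain b (c i) x) (x \in secular_dom b c w).
Proof. by apply: (iffP andP) => -[bx /forallP]. Qed.

Section SecularOrder.
Variables (R : realFieldType) (d : nat) (b : R) (c w : 'I_d -> R).
Hypotheses (d_gt0 : (0 < d)%N) (b_ge0 : 0 <= b) (w_gt0 : forall i, 0 < w i).

Local Notation dom := (secular_dom b c w).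
Local Notation F := (secular b c w).

Lemma secular_dom_up x y : x \in dom -> x <= y -> y \in dom.
Proof.
move=> xD; rewrite le_eqVlt => /predU1P[<-//|xy].
have [bx wx] := secular_domP xD; apply/secular_domP; split=> [|i].
  exact: lt_trans xy.
apply: lt_trans (wx i) _; apply: inv_gain_lt => //; exact: lt_trans (wx i).
Qed.

Lemma secular_decreasing : {in dom &, {mono F : x y /~ x <= y}}.
Proof.
apply: le_nmono_in => x y /secular_domP[_ wx] /secular_domP[lt_by wy] yx.
apply: ltr_sum => [|i _].
  by apply/hasP; exists (Ordinal d_gt0); rewrite ?mem_index_enum.
rewrite ltr_pM2l// ltf_pV2 ?posrE ?subr_gt0// ltrD2r.
by apply: inv_gain_lt => //; exact: lt_trans (wy i).
Qed.

Lemma secular_le1 x : (forall i, (1 + d%:R) * w i <= inv_gain b (c i) x) ->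
  F x <= 1.
Proof.
move=> wx; have dR_gt0 : 0 < d%:R :> R by rewrite ltr0n.
have -> : 1 = \sum_(i < d) d%:R^-1 :> R.
  by rewrite sumr_const card_ord -[_ *+ d]mulr_natl divff ?gt_eqF.
apply: ler_sum => i _; have := wx i.
rewrite mulrDl mul1r addrC -lerBrDr => dw.
by rewrite ler_pdivrMr ?ler_pdivlMl// (lt_le_trans _ dw) ?mulr_gt0.
Qed.

Lemma exists_secular_le1 x : exists2 y, x <= y & F y <= 1.
Proof.
pose s i := c i ^+ 2 + (1 + d%:R) * w i.
have s_ge0 i : 0 <= s i.
  by rewrite addr_ge0 ?sqr_ge0// mulr_ge0 ?addr_ge0 ?ler0n// ltW.
have sum_s_ge0 : 0 <= \sum_i s i by exact: sumr_ge0.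
pose y := Num.max b x + 1 + \sum_i s i.
have [b_max x_max] : b <= Num.max b x /\ x <= Num.max b x.
  by split; rewrite le_max lexx ?orbT.
exists y; first by rewrite /y; lra.
apply: secular_le1 => i; have lt_by : b < y by rewrite /y; lra.
apply: le_trans (inv_gain_ge _ b_ge0 lt_by).
have : s i <= \sum_i s i by rewrite (bigD1 i)//= lerDl sumr_ge0.
by rewrite /y /s; lra.
Qed.

Section SecularRoot.
Variable x : R.
Hypotheses (xD : x \in dom) (Fx : F x = 1).

Lemma secular_root_eq y : x = y <-> y \in dom /\ F y = 1.
Proof.
split=> [<-//|[yD Fy]].
by apply: (dec_inj_in secular_decreasing) => //; rewrite Fx Fy.
Qed.

Lemma secular_root_lt y : x < y <-> y \in dom /\ F y < 1.
Proof.
have F_lt := leW_nmono_in secular_decreasing.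
split=> [xy|[yD]]; last by rewrite -Fx F_lt.
have yD := secular_dom_up xD (ltW xy).
by rewrite -Fx F_lt.
Qed.

Lemma sum_le_secular_root : \sum_i w i <= x.
Proof.
have [bx wx] := secular_domP xD; have x_gt0 : 0 < x by exact: le_lt_trans bx.
have : \sum_i w i / x <= F x.
  apply: ler_sum => i _; rewrite ler_pM2l// lef_pV2 ?posrE ?subr_gt0//.
  rewrite lerBlDr (le_trans (inv_gain_le _ b_ge0 bx))// lerBlDr -addrA lerDl.
  by rewrite addr_ge0 ?divr_ge0 ?sqr_ge0// ltW.
by rewrite Fx -mulr_suml ler_pdivrMr// mul1r.
Qed.

End SecularRoot.

End SecularOrder.

Section SecularExistence.
Variables (R : realType) (d : nat) (b : R) (c w : 'I_d -> R).
Hypotheses (d_gt0 : (0 < d)%N) (b_ge0 : 0 <= b) (w_gt0 : forall i, 0 < w i).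

Local Notation dom := (secular_dom b c w).
Local Notation F := (secular b c w).

Lemma secular_continuous x : x \in dom -> {for x, continuous F}.
Proof.
case/secular_domP => bx wx; have x_gt0 : 0 < x by exact: le_lt_trans bx.
rewrite /secular; apply: cvg_big => [|i _]; first exact: add_continuous.
apply: cvgM; first exact: cvg_cst.
apply: cvgV; first by rewrite gt_eqF// subr_gt0.
apply: cvgB; last exact: cvg_cst.
by apply: inv_gain_continuous; rewrite gt_eqF// ltr_pwDl.
Qed.

(* Where [inv_gain b (c i) x = 2 * w i], the i-th summand is 1; the largest such x
   lies in the domain. *)
Lemma exists_secular_ge1 : exists2 x, x \in dom & 1 <= F x.
Proof.
have /fin_all_exists2[u bu gain_u] i :
    exists2 x, b < x & inv_gain b (c i) x = 2 * w i.
  by apply: inv_gain_surj; rewrite ?mulr_gt0.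
have [i _ /= u_max] := @arg_maxP _ _ _ (Ordinal d_gt0) predT u isT.
have w_lt j : w j < inv_gain b (c j) (u i).
  have w_lt_u : w j < inv_gain b (c j) (u j).
    by rewrite gain_u; have := w_gt0 j; lra.
  have := u_max j isT; rewrite le_eqVlt => /predU1P[<-//|lt_u].
  by apply: lt_trans w_lt_u _; apply: inv_gain_lt; rewrite ?gain_u ?mulr_gt0.
exists (u i); first by apply/secular_domP.
rewrite /secular (bigD1 i)//= gain_u mulrDl mul1r addrK divff ?gt_eqF// lerDl.
by apply: sumr_ge0 => j _; rewrite divr_ge0 ?(ltW (w_gt0 j))// subr_ge0 ltW.
Qed.

Lemma exists_secular_root : exists2 x, x \in dom & F x = 1.
Proof.
have [x xD Fx] := exists_secular_ge1.
have [y xy Fy] := exists_secular_le1 c d_gt0 b_ge0 w_gt0 x.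
have dom_ge_x z : x <= z -> z \in dom by exact: secular_dom_up xD.
have [| | |z + Fz] := @IVT _ F x y 1 => //.
- apply: continuous_in_subspaceT => z; rewrite inE/= in_itv/= => /andP[xz _].
  exact/secular_continuous/dom_ge_x.
- by rewrite ge_min Fy orbT le_max Fx.
- by rewrite in_itv/= => /andP[xz _]; exists z => //; exact: dom_ge_x.
Qed.

End SecularExistence.

(** * The eigenvector of the operator *)

(* The trace of [Amx ((1 - b) * eta) b l]; its determinant is [b]. *)
Definition adam_trace {K : fieldType} (eta b l : K) : K :=
  1 + b - (1 - b) * eta * l.

Definition adam_weight {K : fieldType} (eta b l : K) : K :=
  ((1 - b) * eta * l) ^+ 2.

(* At a root x of the secular equation, the scaling gives the coupling term
   et^2 sum_j sig_j lam_j^2 (W_j)_11 the value 1. *)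
Definition adam_eigvec {K : fieldType} {d : nat} (eta b : K) (lam sig : 'I_d -> K)
    (x : K) (i : 'I_d) : 'M[K]_2 :=
  let k := inv_gain b (adam_trace eta b (lam i)) x in
  (k / (sig i * (k - adam_weight eta b (lam i)))) *:
  lyapunov_sol b (adam_trace eta b (lam i)) x.

Lemma Tadam_adam_eigvec {K : fieldType} {d : nat} (eta b : K)
    (lam sig : 'I_d -> K) (x : K) :
  let c := adam_trace eta b \o lam in let w := adam_weight eta b \o lam in
  let W := adam_eigvec eta b lam sig x in
  x != 0 -> x + b != 0 -> (forall i, sig i != 0) ->
  (forall i, inv_gain b (c i) x != 0) ->
  (forall i, inv_gain b (c i) x - w i != 0) -> secular b c w x = 1 ->
  forall i, Tadam eta b lam sig W i = x *: W i.
Proof.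
move=> c w W x_neq0 xb_neq0 sig_neq0 k_neq0 kw_neq0 Fx i.
have W00 j : W j 0 0 = (sig j * (inv_gain b (c j) x - w j))^-1.
  rewrite !mxE/= mulrAC divff ?mul1r//; exact: k_neq0.
have coupling : ((1 - b) * eta) ^+ 2 *
    (\sum_j sig j * lam j ^+ 2 * W j 0 0) = 1.
  rewrite -[RHS]Fx mulr_sumr; apply: eq_bigr => j _.
  by rewrite W00 invfM [X in _ * X]mulrACA divff ?sig_neq0// mul1r mulrA -exprMn.
have scaleE : ((1 - b) * eta) ^+ 2 * (lam i ^+ 2 * W i 0 0 +
    (sig i)^-1 * \sum_j sig j * lam j ^+ 2 * W j 0 0) =
    inv_gain b (c i) x / (sig i * (inv_gain b (c i) x - w i)).
  rewrite mulrDr mulrA [_ * (_^-1 * _)]mulrCA coupling mulr1 -exprMn W00.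
  rewrite -[in RHS](subrK (w i) (inv_gain b (c i) x)) addrK.
  by rewrite [RHS]mulrDl [RHS]addrC invfM [X in _ = _ + X]mulrCA divff// mulr1.
rewrite /Tadam scaleE /W /adam_eigvec -scalemxAr -scalemxAl -scalerDr.
by rewrite lyapunov_solP ?k_neq0// !scalerA mulrC.
Qed.

Section AdamSecular.
Variables (R : realFieldType) (d : nat) (eta b : R) (lam sig : 'I_d -> R).
Hypotheses (eta_gt0 : 0 < eta) (b_ge0 : 0 <= b) (b_lt1 : b < 1).
Hypotheses (lam_gt0 : forall i, 0 < lam i) (sig_gt0 : forall i, 0 < sig i).

Local Notation c := (adam_trace eta b \o lam).
Local Notation w := (adam_weight eta b \o lam).

Lemma adam_weight_gt0 i : 0 < w i.
Proof. by rewrite /= /adam_weight exprn_gt0// !mulr_gt0 ?subr_gt0. Qed.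

Lemma sum_adam_weight :
  \sum_i w i = ((1 - b) * eta) ^+ 2 * \sum_i lam i ^+ 2.
Proof. by rewrite mulr_sumr; apply: eq_bigr => i _; rewrite -exprMn. Qed.

Lemma adam_eigvec_pd x i : x \in secular_dom b c w ->
  pd2 (adam_eigvec eta b lam sig x i).
Proof.
case/secular_domP => bx /(_ i) wx; have k_gt0 := lt_trans (adam_weight_gt0 i) wx.
apply: pd2Z; last exact: lyapunov_sol_pd.
by rewrite divr_gt0// mulr_gt0// subr_gt0.
Qed.

Lemma adam_eigvec_eigen x i : x \in secular_dom b c w -> secular b c w x = 1 ->
  Tadam eta b lam sig (adam_eigvec eta b lam sig x) i =
  x *: adam_eigvec eta b lam sig x i.
Proof.
case/secular_domP => bx wx Fx; have x_gt0 : 0 < x by exact: le_lt_trans bx.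
apply: Tadam_adam_eigvec => // [||j|j|j]; rewrite gt_eqF//.
- exact: ltr_pwDl.
- exact: lt_trans (adam_weight_gt0 j) (wx j).
- by rewrite subr_gt0 wx.
Qed.

Lemma inv_gain_sub_weight_at1 i : inv_gain b (c i) 1 - w i =
  2 * ((1 - b) * eta * lam i) * (1 - b) * (1 - eta * lam i / (1 + b)).
Proof.
rewrite /inv_gain /= /adam_trace /adam_weight; field.
by rewrite gt_eqF ?ltr_pwDl.
Qed.

Lemma one_secular_dom i : (forall j, lam j <= lam i) ->
  (1 \in secular_dom b c w) = (eta * lam i < 1 + b).
Proof.
move=> lam_max; have b1_gt0 : 0 < 1 + b by exact: ltr_pwDl.
have ltE j : (w j < inv_gain b (c j) 1) = (eta * lam j < 1 + b).
  rewrite -subr_gt0 inv_gain_sub_weight_at1 pmulr_rgt0.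
    by rewrite subr_gt0 ltr_pdivrMr ?mul1r.
  by rewrite !mulr_gt0 ?subr_gt0.
apply/secular_domP/idP => [[_ /(_ i)]|lt_lam]; first by rewrite ltE.
by split=> // j; rewrite ltE (le_lt_trans _ lt_lam)// ler_pM2l.
Qed.

(* If [eta * lam i = 1 + b], the i-th summand is 0 on both sides, as a fraction
   with denominator 0. *)
Lemma secular_at1 : secular b c w 1 = S_adam eta b lam.
Proof.
apply: eq_bigr => i _; rewrite inv_gain_sub_weight_at1 /= /adam_weight.
have [b_neq1 eta_neq0 lam_neq0] : [/\ 1 - b != 0, eta != 0 & lam i != 0].
  by split; rewrite gt_eqF ?subr_gt0.
by rewrite !invfM !mulrA; congr (_ / _); field; rewrite b_neq1 eta_neq0 lam_neq0.
Qed.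

End AdamSecular.

Theorem theoremA5 (R : realType) (d : nat) (hd : (0 < d)%N)
    (P H U S : 'M[R]_d) (lam sig : 'I_d -> R) (eta b1 : R)
    (* P > 0, H >= 0 symmetric, commuting *)
    (hPsym : P^T = P) (hHsym : H^T = H)
    (hPpd : forall v : 'rV[R]_d, v != 0 -> 0 < (v *m P *m v^T) 0 0)
    (hHpsd : forall v : 'rV[R]_d, 0 <= (v *m H *m v^T) 0 0)
    (hPH : P *m H = H *m P)
    (* lam_1 >= ... >= lam_d > 0 are the eigenvalues of P^-1 H *)
    (hlam_eig : char_poly (invmx P *m H) = \prod_(i < d) ('X - (lam i)%:P))
    (hlam_sorted : forall i j : 'I_d, (i <= j)%N -> lam j <= lam i)
    (hlam_pos : forall i, 0 < lam i)
    (* eta > 0, beta1 in [0,1) *)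
    (heta : 0 < eta) (hb1 : 0 <= b1) (hb1' : b1 < 1)
    (* sigma_i > 0; orthonormal basis U diagonalizing P and P^-1/2 H P^-1/2,
       where S = P^-1/2 is the symmetric positive definite square root of P^-1 *)
    (hsig : forall i, 0 < sig i)
    (hU : U *m U^T = 1%:M)
    (hSsym : S^T = S)
    (hSpd : forall v : 'rV[R]_d, v != 0 -> 0 < (v *m S *m v^T) 0 0)
    (hS : S *m S = invmx P)
    (hUP : U *m P *m U^T = diag_mx (\row_i sig i))
    (hUH : U *m (S *m H *m S) *m U^T = diag_mx (\row_i lam i)) :
  let et := (1 - b1) * eta in
  let rho := rho_adam eta b1 lam sig in
  let lam1 := lam (Ordinal hd) in
  (* (a) *)
  ((forall W : 'I_d -> 'M[R]_2, inK W -> inK (Tadam eta b1 lam sig W)) /\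
   Tadam_eigenvalue eta b1 lam sig (rho%:C) /\
   (exists Wst : 'I_d -> 'M[R]_2,
      inK Wst /\ nonzeroX Wst /\
      (forall i, Tadam eta b1 lam sig Wst i = rho *: Wst i) /\
      0 < \sum_(i < d) Wst i 0 0) /\
   et ^+ 2 * (\sum_(i < d) lam i ^+ 2) <= rho /\
   0 < et ^+ 2 * (\sum_(i < d) lam i ^+ 2)) /\
  (* (b) *)
  (rho = 1 <-> (eta * lam1 < 1 + b1 /\ S_adam eta b1 lam = 1)) /\
  (* (c) *)
  (rho < 1 <-> (eta * lam1 < 1 + b1 /\ S_adam eta b1 lam < 1)).
Proof.
move=> et rho lam1.
pose c := adam_trace eta b1 \o lam; pose w := adam_weight eta b1 \o lam.
have w_gt0 : forall i, 0 < w i by exact: adam_weight_gt0.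
have [x xD Fx] := exists_secular_root c hd hb1 w_gt0.
have x_gt0 : 0 < x by have [bx _] := secular_domP xD; exact: le_lt_trans bx.
pose W := adam_eigvec eta b1 lam sig x.
have pdW : forall i, pd2 (W i) by move=> i; exact: adam_eigvec_pd.
have TW : forall i, Tadam eta b1 lam sig W i = x *: W i.
  by move=> i; exact: adam_eigvec_eigen.
have rhoE : rho = x by exact: rho_adamE (ltW x_gt0) TW.
have dom1 : (1 \in secular_dom b1 c w) = (eta * lam1 < 1 + b1).
  by apply: one_secular_dom => // i; exact: hlam_sorted.
have F1 : secular b1 c w 1 = S_adam eta b1 lam by exact: secular_at1.
rewrite rhoE -sum_adam_weight -dom1 -F1; split; last first.
  by split; [exact: secular_root_eq|exact: secular_root_lt].
split; first by move=> V; exact: Tadam_inK.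
split; first exact: Tadam_eigenvalue_pd TW.
split; last first.
  by split; [exact: (sum_le_secular_root hb1 w_gt0 xD)|exact: sumr_ord_gt0].
exists W; split; first by move=> i; exact: pd2_psd.
split; first by exists (Ordinal hd); exact: pd2_neq0.
by split=> //; apply: sumr_ord_gt0 => // i; have [] := pdW i.
Qed.
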